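(* Consider the problems $(\mathcal P)$ and $(\mathcal D)$ defined in the context. (a) (Weak duality) Suppose that for every $L\in\mathcal L$ the random variables $\phi_j(X)L(X)$, $j=0,\ldots,l$, are integrable with respect to $g$. Then $val(\mathcal P)\le val(\mathcal D)$. (b) (Strong duality) Suppose in addition that (i) $\mathcal L$ is a convex set; and (ii) there exists $L_0\in\mathcal L$ such that $\mathbb E_g[\phi_j(X)L_0(X)]<\mu_j$ for $j=1,\ldots,m$ and $\mathbb E_g[\phi_j(X)L_0(X)]=\mu_j$ for $j=m+1,\ldots,l$, and moreover $(\mu_{m+1},\ldots,\mu_l)$ is an interior point of the set $\{(\mathbb E_g[\phi_{m+1}(X)L(X)],\ldots,\mathbb E_g[\phi_l(X)L(X)]):L\in\mathcal L\}\subset\mathbb R^{l-m}$. Then $val(\mathcal P)=val(\mathcal D)$.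
   Context: Setting. $\mathcal X$ is a subset of a Euclidean space, $\phi_0,\ldots,\phi_l:\mathcal X\to\mathbb R$ are known functions, $0\le m\le l$, and $\mu_1,\ldots,\mu_l\in\mathbb R$. One of $\phi_1,\ldots,\phi_l$ is the indicator $I(x\in\mathcal X)$ (total mass constraint). $\mathcal F$ is a class of nonnegative functions (densities whose total mass is prescribed only through the moment constraints) on $\mathcal X$. $g$ is a fixed positive probability density on $\mathcal X$, $X$ is a random variable with density $g$, $\mathbb E_g$ is expectation under $g$, and $\mathcal L=\{f/g:f\in\mathcal F\}$. Problem $(\mathcal P)$: $$\sup_{L\in\mathcal L}\ \mathbb E_g[\phi_0(X)L(X)]\quad\text{subject to}\quad \mathbb E_g[\phi_j(X)L(X)]\le\mu_j,\ j=1,\ldots,m,\qquad \mathbb E_g[\phi_j(X)L(X)]=\mu_j,\ j=m+1,\ldots,l.$$ Lagrangian dual $(\mathcal D)$: $$\inf_{\lambda\in\mathbb R_+^m\times\mathbb R^{l-m}}\ \sup_{L\in\mathcal L}\Big\{\mathbb E_g[\phi_0(X)L(X)]-\sum_{j=1}^l\lambda_j\big(\mathbb E_g[\phi_j(X)L(X)]-\mu_j\big)\Big\}.$$ $val(\cdot)$ denotes the optimal value in $[-\infty,\infty]$ (with $\sup\emptyset=-\infty$). If $l=m$, the interior point condition is vacuous. *)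

(* Defs.v *)
From HB Require Import structures.
From mathcomp Require Import all_boot all_order all_algebra.
From mathcomp Require Import all_classical all_reals all_analysis.
Import Order.TTheory GRing.Theory Num.Theory.
Import numFieldNormedType.Exports.

Set Implicit Arguments.
Unset Strict Implicit.
Unset Printing Implicit Defensive.

Local Open Scope classical_set_scope.
Local Open Scope ring_scope.

(* R^d is modelled by d.-tuple R, whose library sigma-algebra is the one
   generated by the coordinates, i.e. the Borel sigma-algebra.  The library has
   no d-dimensional Lebesgue measure: it is built here as the d-fold product. *)
Section lebesgue_tuple.
Context (R : realType).

Definition tuple_cons (n : nat) (p : measurableTypeR R * n.-tuple R) : n.+1.-tuple R :=
  [the n.+1.-tuple R of p.1 :: p.2].

Lemma measurable_tuple_cons n : measurable_fun setT (@tuple_cons n).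
Proof. by apply: measurable_cons; [exact: measurable_fst | exact: measurable_snd]. Qed.

Section step.
Context (n : nat) (mu : {sigma_finite_measure set (n.-tuple R) -> \bar R}).

Definition lebesgue_cons : set (n.+1.-tuple R) -> \bar R :=
  pushforward (product_measure1 (@lebesgue_measure R) mu) (@tuple_cons n).

Let lebesgue_cons0 : lebesgue_cons set0 = 0%E.
Proof. exact: (measure0 (product_measure1 _ mu)). Qed.

Let lebesgue_cons_ge0 A : (0 <= lebesgue_cons A)%E.
Proof. exact: (measure_ge0 (product_measure1 _ mu)). Qed.

Let lebesgue_cons_sigma_additive : semi_sigma_additive lebesgue_cons.
Proof.
apply: measure_semi_sigma_additive; exact: measurable_tuple_cons.
Qed.

HB.instance Definition _ := isMeasure.Build _ _ _ lebesgue_cons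
  lebesgue_cons0 lebesgue_cons_ge0 lebesgue_cons_sigma_additive.

Let lebesgue_cons_sigma_finite : sigma_finite setT lebesgue_cons.
Proof.
have /sigma_finiteP[F [FT ndF Foo]] := sigma_finiteT (@lebesgue_measure R).
have /sigma_finiteP[G [GT ndG Goo]] := sigma_finiteT mu.
pose u (t : n.+1.-tuple R) : measurableTypeR R * n.-tuple R :=
  (thead t, [tuple of behead t]).
have mu_ : measurable_fun setT u.
  by apply: measurable_fun_pair;
    [exact: measurable_tnth | exact: measurable_behead].
have uK p : u (tuple_cons p) = p.
  by case: p => x t; congr pair; apply: val_inj.
exists (fun k => u @^-1` (F k `*` G k)).
  apply/esym; rewrite -subTset => t _ /=.
  have [i _ Fi] : (\bigcup_i F i) (u t).1 by rewrite -FT.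
  have [j _ Gj] : (\bigcup_i G i) (u t).2 by rewrite -GT.
  exists (maxn i j) => //; split.
    by move: Fi; apply/subsetPset/ndF/leq_maxl.
  by move: Gj; apply/subsetPset/ndG/leq_maxr.
move=> k; have [mF Fk] := Foo k; have [mG Gk] := Goo k; split.
  by rewrite -[X in measurable X]setTI; apply: mu_ => //; exact: measurableX.
rewrite /lebesgue_cons /pushforward -comp_preimage.
rewrite (_ : u \o _ = id); last by apply/funext => p /=; exact: uK.
rewrite preimage_id product_measure1E// lte_mul_pinfty//.
by rewrite ge0_fin_numE.
Qed.

HB.instance Definition _ :=
  Measure_isSigmaFinite.Build _ _ _ lebesgue_cons lebesgue_cons_sigma_finite.

End step.

Fixpoint lebesgue_tuple (d : nat) :
    {sigma_finite_measure set (d.-tuple R) -> \bar R} :=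
  match d with
  | 0 => [the {sigma_finite_measure set (0.-tuple R) -> \bar R} of
            \d_([tuple] : 0.-tuple R)]
  | n.+1 => [the {sigma_finite_measure set (n.+1.-tuple R) -> \bar R} of
               lebesgue_cons (lebesgue_tuple n)]
  end.

End lebesgue_tuple.

Section problems.
Context (R : realType) (d : nat) (S : set (d.-tuple R)).

Definition is_positive_density (g : d.-tuple R -> R) :=
  [/\ measurable_fun S g, (forall x, S x -> 0 < g x) &
      (\int[lebesgue_tuple R d]_(x in S) (g x)%:E = 1)%E].

Definition has_density (dO : measure_display) (Omega : measurableType dO)
    (P : probability Omega R) (X : {RV P >-> d.-tuple R})
    (g : d.-tuple R -> R) :=
  forall A, measurable A ->
    (distribution P X A = \int[lebesgue_tuple R d]_(x in A `&` S) (g x)%:E)%E.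

(* Functions on S are represented by total functions; the ratios are set to 0
   off S, so that this set is in bijection with a set of functions on S. *)
Definition likelihood_ratios (g : d.-tuple R -> R) (F : set (d.-tuple R -> R)) :
    set (d.-tuple R -> R^o) :=
  [set (fun x => f x / g x) \_ S | f in F].

Context (dO : measure_display) (Omega : measurableType dO)
  (P : probability Omega R) (X : Omega -> d.-tuple R).

Definition moment (h L : d.-tuple R -> R) : \bar R :=
  ('E_P[fun w => (h (X w) * L (X w))%R])%E.

Definition moment_integrable (h L : d.-tuple R -> R) : Prop :=
  P.-integrable setT (EFin \o (fun w => h (X w) * L (X w))).

(* m inequality constraints (indices lshift k i), then k = l - m equality
   constraints (indices rshift m i). *)
Context (m k : nat) (phi0 : d.-tuple R -> R)
  (phi : 'I_(m + k) -> d.-tuple R -> R) (mu : 'I_(m + k) -> R)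
  (LL : set (d.-tuple R -> R)).

Definition primal_feasible : set (d.-tuple R -> R) :=
  [set L | [/\ LL L,
    forall i : 'I_m, (moment (phi (lshift k i)) L <= (mu (lshift k i))%:E)%E &
    forall i : 'I_k, moment (phi (rshift m i)) L = (mu (rshift m i))%:E]].

Definition val_primal : \bar R :=
  ereal_sup [set moment phi0 L | L in primal_feasible].

Definition dual_feasible : set ('I_(m + k) -> R) :=
  [set lambda | forall i : 'I_m, 0 <= lambda (lshift k i)].

Definition lagrangian (lambda : 'I_(m + k) -> R) (L : d.-tuple R -> R) :
    \bar R :=
  (moment phi0 L -
   \sum_(j < m + k) (lambda j)%:E * (moment (phi j) L - (mu j)%:E))%E.

Definition val_dual : \bar R :=
  ereal_inf [set ereal_sup [set lagrangian lambda L | L in LL]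
            | lambda in dual_feasible].

Definition equality_moments : set 'rV[R]_k :=
  [set v | exists2 L, LL L &
    forall i : 'I_k, moment (phi (rshift m i)) L = (v ord0 i)%:E].

Definition interior_point_condition : Prop :=
  (exists L0, [/\ LL L0,
    forall i : 'I_m, (moment (phi (lshift k i)) L0 < (mu (lshift k i))%:E)%E &
    forall i : 'I_k, moment (phi (rshift m i)) L0 = (mu (rshift m i))%:E]) /\
  (equality_moments° (\row_(i < k) mu (rshift m i))).

End problems.

(* Main.v *)
(* The moments are affine functions of L.  Constraints are moved into the
   objective one at a time, the inequalities first and the equalities last.
   With a single constraint h, where a <= p at every point with h = 0, the
   multiplier has to lie above (a x - p) / h x whenever h x > 0 and below
   (a y - p) / h y whenever h y < 0; these bounds are compatible because the
   segment from x to y meets h = 0.  Slater's condition (inequalities) and the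
   interior point condition (equalities) say that h takes the required signs
   at points that satisfy the constraints still to be removed. *)
Require Import Defs.
From HB Require Import structures.
From mathcomp Require Import all_boot all_order all_algebra.
From mathcomp Require Import all_classical all_reals all_analysis.
From mathcomp Require Import ring lra.
Import Order.TTheory GRing.Theory Num.Theory.
Import numFieldNormedType.Exports.

Local Open Scope classical_set_scope.
Local Open Scope ring_scope.
Local Open Scope convex_scope.

(** * Lagrange multipliers for affine functions on a convex set *)

Section lagrange_multipliers.
Context {R : realType} {E : convType R}.
Implicit Types (C : set E) (a h : E -> R) (p : R).

Definition conv_stable C :=
  forall x y (t : {i01 R}), C x -> C y -> C (x <| t |> y).

(** Required on [C] only, because the moments are known to be finite, hence affine as real
    functions, only on the given class. *)
Definition affine_on C h := forall x y (t : {i01 R}), C x -> C y ->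
  h (x <| t |> y) = t%:num * h x + (1 - t%:num) * h y.

Lemma affine_on_subset C C' h : C' `<=` C -> affine_on C h -> affine_on C' h.
Proof. by move=> sub hh x y t /sub Cx /sub Cy; exact: hh. Qed.

Lemma affine_onB C a h (c : R) : affine_on C a -> affine_on C h ->
  affine_on C (fun x => a x - c * h x).
Proof. by move=> ha hh x y t Cx Cy; rewrite ha// hh//; ring. Qed.

Lemma affine_onB_sum C a n (h : 'I_n -> E -> R) (c : 'I_n -> R) :
  affine_on C a -> (forall i, affine_on C (h i)) ->
  affine_on C (fun x => a x - \sum_(i < n) c i * h i x).
Proof.
move=> ha hh x y t Cx Cy; rewrite ha//.
rewrite (eq_bigr (fun i => t%:num * (c i * h i x) +
    (1 - t%:num) * (c i * h i y))); last by move=> i _; rewrite hh//; ring.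
by rewrite big_split/= -!mulr_sumr; ring.
Qed.

Lemma conv_stable_le0 C h : conv_stable C -> affine_on C h ->
  conv_stable [set x | C x /\ h x <= 0].
Proof.
move=> cC hh x y t [Cx hx] [Cy hy]; split; first exact: cC.
have t0 : 0 <= t%:num by [].
have t1 : 0 <= 1 - t%:num by rewrite subr_ge0.
by rewrite hh//; nra.
Qed.

Lemma conv_stable_eq0 C h : conv_stable C -> affine_on C h ->
  conv_stable [set x | C x /\ h x = 0].
Proof.
move=> cC hh x y t [Cx hx] [Cy hy]; split; first exact: cC.
by rewrite hh// hx hy !mulr0 addr0.
Qed.

(** [Q] stands for [r <= 0] when inequalities are kept as constraints and for [r = 0] when
    equalities are. *)
Lemma conv_stable_bigcap C (I : Type) (h : I -> E -> R) (Q : R -> Prop) :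
  conv_stable C ->
  (forall i, conv_stable [set x | C x /\ Q (h i x)]) ->
  conv_stable [set x | C x /\ forall i, Q (h i x)].
Proof.
move=> cC cQ x y t [Cx hx] [Cy hy]; split; first exact: cC.
by move=> i; have [] := cQ i x y t (conj Cx (hx i)) (conj Cy (hy i)).
Qed.

Lemma multiplier_eq C a h p : conv_stable C -> affine_on C a ->
  affine_on C h -> (exists2 x, C x & 0 < h x) -> (exists2 x, C x & h x < 0) ->
  (forall x, C x -> h x = 0 -> a x <= p) ->
  exists l, forall x, C x -> a x - l * h x <= p.
Proof.
move=> cC ha hh [x0 Cx0 hx0] [y0 Cy0 hy0] ap.
have slope x y : C x -> C y -> 0 < h x -> h y < 0 ->
    (a x - p) / h x <= (a y - p) / h y.
  move=> Cx Cy hx hy.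
  have hxy : 0 < h x - h y by lra.
  (* This weight solves [t * h x + (1 - t) * h y = 0]: it marks where the segment crosses
     [h = 0]. *)
  have t0 : 0 <= - h y / (h x - h y) by apply: divr_ge0; lra.
  have t1 : - h y / (h x - h y) <= 1 by rewrite ler_pdivrMr//; lra.
  pose t := Itv01 t0 t1.
  have tE : t%:num * (h x - h y) = - h y.
    by rewrite /= divfK// gt_eqF.
  have := ap _ (cC x y t Cx Cy).
  rewrite hh// ha//; move: tE; set s := t%:num => tE.
  have -> : s * h x + (1 - s) * h y = s * (h x - h y) + h y by ring.
  rewrite tE addNr => /(_ erefl).
  (* Multiplying by [h x - h y] clears the denominator of the weight and leaves
     [h x * a y - h y * a x <= p * (h x - h y)], the slope inequality cross-multiplied. *)
  rewrite -(ler_pM2r hxy) => le_p.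
  rewrite ler_pdivrMr// mulrAC -(ler_nM2r hy) divfK ?lt_eqF//.
  have : (s * a x + (1 - s) * a y) * (h x - h y) =
    s * (h x - h y) * a x + (h x - h y - s * (h x - h y)) * a y by ring.
  by rewrite tE => eq_s; lra.
pose A := [set (a x - p) / h x | x in [set x | C x /\ 0 < h x]].
have A0 : A !=set0 by exists ((a x0 - p) / h x0), x0.
have Aub y : C y -> h y < 0 -> ubound A ((a y - p) / h y).
  by move=> Cy hy _ [x [Cx hx] <-]; exact: slope.
(* The least admissible multiplier. The supremum is a genuine one: [x0] makes [A] nonempty and [y0]
   bounds it. *)
exists (sup A) => x Cx; have [hx|hx|hx] := ltgtP (h x) 0.
- have : sup A <= (a x - p) / h x by apply: ge_sup => //; exact: Aub.
  by rewrite -(ler_nM2r hx) divfK ?lt_eqF//; lra.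
- have : (a x - p) / h x <= sup A.
    apply: ub_le_sup; last by exists x.
    by exists ((a y0 - p) / h y0); exact: Aub.
  by rewrite ler_pdivrMr//; lra.
- by rewrite hx mulr0 subr0; exact: ap.
Qed.

(** If [h] also takes positive values, the equality case yields some [l]. When that [l] is negative,
    or when [h] is never positive, the multiplier 0 works: where [h x > 0], a bound with [l <= 0]
    already forces [a x <= p]. *)
Lemma multiplier_le C a h p : conv_stable C -> affine_on C a ->
  affine_on C h -> (exists2 x, C x & h x < 0) ->
  (forall x, C x -> h x <= 0 -> a x <= p) ->
  exists2 l, 0 <= l & forall x, C x -> a x - l * h x <= p.
Proof.
move=> cC ha hh hneg ap.
have zero l : l <= 0 -> (forall x, C x -> 0 < h x -> a x - l * h x <= p) ->
    exists2 l, 0 <= l & forall x, C x -> a x - l * h x <= p.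
  move=> l0 alp; exists 0 => // x Cx; rewrite mul0r subr0.
  have [hx|hx] := leP (h x) 0; first exact: ap.
  by have := alp _ Cx hx; nra.
have [hpos|hpos] := pselect (exists2 x, C x & 0 < h x); last first.
  by apply: (zero 0) => // x Cx hx; case: hpos; exists x.
have ap0 x : C x -> h x = 0 -> a x <= p by move=> Cx hx; apply: ap; rewrite ?hx.
have [l al] := multiplier_eq C a h p cC ha hh hpos hneg ap0.
have [l0|l0] := leP 0 l; first by exists l.
by apply: (zero l); [exact: ltW|move=> x Cx _; exact: al].
Qed.

(** Induction on [n]: the first constraint gets its multiplier on the set [D] where the others hold,
    its term joins the objective, and the induction hypothesis treats the others on all of [C]. The
    same strict point [x0] serves throughout. *)
Lemma multipliers_le n C a (h : 'I_n -> E -> R) p : conv_stable C ->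
  affine_on C a -> (forall i, affine_on C (h i)) ->
  (exists2 x, C x & forall i, h i x < 0) ->
  (forall x, C x -> (forall i, h i x <= 0) -> a x <= p) ->
  exists2 l : 'I_n -> R, (forall i, 0 <= l i) &
    forall x, C x -> a x - \sum_(i < n) l i * h i x <= p.
Proof.
elim: n C a h => [|n IH] C a h cC ha hh [x0 Cx0 hx0] ap.
  exists (fun=> 0) => // x Cx; rewrite big_ord0 subr0.
  by apply: ap => // [[]].
pose h' i := h (lift ord0 i).
pose D := [set x | C x /\ forall i, h' i x <= 0].
have DC : D `<=` C by move=> x [].
have cD : conv_stable D.
  apply: (conv_stable_bigcap C _ _ (fun r => r <= 0)) => // i.
  by apply: conv_stable_le0 => //; exact: hh.
have [l0 l0_ge0 al0] : exists2 l, 0 <= l &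
    forall x, D x -> a x - l * h ord0 x <= p.
  apply: multiplier_le => //; [exact: affine_on_subset ha
    |exact: affine_on_subset (hh _)| |].
    by exists x0 => //; split=> // i; exact/ltW/hx0.
  move=> x [Cx h'x] hx; apply: ap => // i.
  by case: (unliftP ord0 i) => [j|] ->; [exact: h'x|].
have [||||l l_ge0 al] := IH C (fun x => a x - l0 * h ord0 x) h' cC.
- exact: affine_onB.
- by move=> i; exact: hh.
- by exists x0 => // i; exact: hx0.
- by move=> x Cx h'x; exact: al0.
(* [l0] at index [ord0], [l] at the lifted indices. *)
exists (fun i => oapp l l0 (unlift ord0 i)).
  by move=> i; case: unlift => //=.
move=> x Cx; rewrite big_ord_recl unlift_none/= opprD addrA.
by under eq_bigr do rewrite liftK/=; exact: al.
Qed.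

(** The same induction, with a box of attained values in place of a strict point; slices of the box
    give both signs of one function while the others vanish. *)
Lemma multipliers_eq n C a (h : 'I_n -> E -> R) p (e : R) : conv_stable C ->
  affine_on C a -> (forall i, affine_on C (h i)) -> 0 < e ->
  (forall v : 'I_n -> R, (forall i, `|v i| < e) ->
    exists2 x, C x & forall i, h i x = v i) ->
  (forall x, C x -> (forall i, h i x = 0) -> a x <= p) ->
  exists l : 'I_n -> R,
    forall x, C x -> a x - \sum_(i < n) l i * h i x <= p.
Proof.
move=> cC + + e0.
elim: n a h => [|n IH] a h ha hh hint ap.
  exists (fun=> 0) => x Cx; rewrite big_ord0 subr0.
  by apply: ap => // [[]].
pose h' i := h (lift ord0 i).
pose D := [set x | C x /\ forall i, h' i x = 0].
have DC : D `<=` C by move=> x [].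
have cD : conv_stable D.
  apply: (conv_stable_bigcap C _ _ (fun r => r = 0)) => // i.
  by apply: conv_stable_eq0 => //; exact: hh.
have hD r : `|r| < e -> exists2 x, D x & h ord0 x = r.
  move=> re; have [i|x Cx hx] := hint (fun i => if i == ord0 then r else 0).
    by case: ifP; rewrite ?normr0.
  exists x; last by rewrite hx.
  by split=> // i; rewrite /h' hx.
have [l0 al0] : exists l, forall x, D x -> a x - l * h ord0 x <= p.
  apply: multiplier_eq => //; [exact: affine_on_subset ha
    |exact: affine_on_subset (hh _)| | |].
  (* The values [e / 2] and [- (e / 2)] lie inside the box and supply the two signs. *)
  - have [|x Dx hx] := hD (e / 2); first by rewrite gtr0_norm; lra.
    by exists x => //; rewrite hx; lra.
  - have [|x Dx hx] := hD (- (e / 2)); first by rewrite normrN gtr0_norm; lra.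
    by exists x => //; rewrite hx; lra.
  move=> x [Cx h'x] hx; apply: ap => // i.
  by case: (unliftP ord0 i) => [j|] ->; [exact: h'x|].
have [||||l al] := IH (fun x => a x - l0 * h ord0 x) h'.
- exact: affine_onB.
- by move=> i; exact: hh.
(* The smaller box is the slice of the full one with value 0 at [ord0]. *)
- move=> v ve; have [i|x Cx hx] := hint (fun i => oapp v 0 (unlift ord0 i)).
    by case: unlift => [j|] /=; rewrite ?normr0.
  by exists x => // i; rewrite /h' hx liftK.
- by move=> x Cx h'x; exact: al0.
exists (fun i => oapp l l0 (unlift ord0 i)) => x Cx.
rewrite big_ord_recl unlift_none/= opprD addrA.
by under eq_bigr do rewrite liftK/=; exact: al.
Qed.

(** The order matters: the points realising the box need not satisfy the inequalities, so these are
    removed first, on the set [D] of the equalities, which contains the strict point. *)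
Lemma lagrange_multipliers m k C a (h : 'I_(m + k) -> E -> R) p (e : R) :
  conv_stable C -> affine_on C a -> (forall j, affine_on C (h j)) ->
  (exists x, [/\ C x, forall i, h (lshift k i) x < 0 &
    forall i, h (rshift m i) x = 0]) ->
  0 < e ->
  (forall v : 'I_k -> R, (forall i, `|v i| < e) ->
    exists2 x, C x & forall i, h (rshift m i) x = v i) ->
  (forall x, C x -> (forall i, h (lshift k i) x <= 0) ->
    (forall i, h (rshift m i) x = 0) -> a x <= p) ->
  exists2 l : 'I_(m + k) -> R, (forall i, 0 <= l (lshift k i)) &
    forall x, C x -> a x - \sum_(j < m + k) l j * h j x <= p.
Proof.
move=> cC ha hh [x0 [Cx0 hx0 hx0']] e0 hint ap.
pose D := [set x | C x /\ forall i, h (rshift m i) x = 0].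
have DC : D `<=` C by move=> x [].
have cD : conv_stable D.
  apply: (conv_stable_bigcap C _ _ (fun r => r = 0)) => // i.
  by apply: conv_stable_eq0 => //; exact: hh.
have [||||l1 l1_ge0 al1] := multipliers_le m D a (fun i => h (lshift k i)) p cD.
- exact: affine_on_subset ha.
- by move=> i; exact: affine_on_subset (hh _).
- by exists x0.
- by move=> x [Cx hx] hx'; exact: ap.
have [||||l2 al2] := multipliers_eq k C
  (fun x => a x - \sum_(i < m) l1 i * h (lshift k i) x)
  (fun i => h (rshift m i)) p e cC _ _ e0.
- by apply: affine_onB_sum.
- by move=> i; exact: hh.
- exact: hint.
- by move=> x Cx hx; exact: al1.
exists (fun j => match fintype.split j with inl i => l1 i | inr i => l2 i end).
  by move=> i; rewrite (unsplitK (inl i)).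
move=> x Cx; rewrite big_split_ord/= opprD addrA.
under eq_bigr do rewrite (unsplitK (inl _)).
under [X in _ - X]eq_bigr do rewrite (unsplitK (inr _)).
exact: al2.
Qed.

End lagrange_multipliers.

(** * Moments as affine functions of the likelihood ratio *)

Section moments.
Context {R : realType} {d : nat} {dO : measure_display}
  {Omega : measurableType dO} (P : probability Omega R)
  (X : Omega -> d.-tuple R).

Lemma momentE (h L : d.-tuple R -> R) : moment_integrable P X h L ->
  moment P X h L = (fine (moment P X h L))%:E.
Proof.
move=> hL; rewrite fineK// /moment expectation.unlock.
exact: integrable_fin_num.
Qed.

(** Linearity of the integral; the constant [c] survives because the weights add up to 1. *)
Lemma moment_affine (LL : set (convex_lmodType (d.-tuple R -> R^o)))
    (h : d.-tuple R -> R) (c : R) :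
  (forall L, LL L -> moment_integrable P X h L) ->
  affine_on LL (fun L => fine (moment P X h L) - c).
Proof.
move=> hLL L M t /hLL hL /hLL hM.
suff -> : moment P X h (L <| t |> M) = (t%:num%:E * moment P X h L +
    (1 - t%:num)%:E * moment P X h M)%E.
  by rewrite (momentE _ _ hL) (momentE _ _ hM)/=; ring.
rewrite /moment expectation.unlock -!integralZl//=.
rewrite -integralD//=; [|exact: integrableZl..].
apply: eq_integral => w _; rewrite -!EFinM -EFinD; congr EFin.
(* Convex combinations of functions are pointwise by conversion. *)
change ((L <| t |> M) (X w)) with (t%:num * L (X w) + (1 - t%:num) * M (X w)).
by ring.
Qed.

(** Balls of row vectors are taken entrywise, so an interior point comes with a whole box of
    attained moments. *)
Lemma equality_moments_ball (k n : nat) (phi : 'I_(n + k) -> d.-tuple R -> R)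
    (LL : set (d.-tuple R -> R)) (c : 'rV[R]_k) :
  (equality_moments P X phi LL)° c ->
  exists2 e : R, 0 < e & forall v : 'I_k -> R, (forall i, `|v i| < e) ->
    exists2 L, LL L &
      forall i, moment P X (phi (rshift n i)) L = (c ord0 i + v i)%:E.
Proof.
move=> /nbhs_ballP[e /= e0 ce]; exists e => // v ve.
have [|L LLL HL] := ce (c + \row_i v i).
  split=> // i j; rewrite /ball /= !mxE opprD addrA (ord1 i) subrr sub0r normrN.
  exact: ve.
by exists L => // i; rewrite HL !mxE.
Qed.

End moments.

(** * Weak and strong duality *)

Section duality.
Context {R : realType} {d : nat} {dO : measure_display}
  {Omega : measurableType dO} (P : probability Omega R)
  (X : Omega -> d.-tuple R) (m k : nat) (phi0 : d.-tuple R -> R)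
  (phi : 'I_(m + k) -> d.-tuple R -> R) (mu : 'I_(m + k) -> R).

(** Objective and constraints as real functions, the latter recentred at 0; on [LL] integrability
    makes [fine] lossless. *)
Let a (L : d.-tuple R -> R) := fine (moment P X phi0 L).
Let h j (L : d.-tuple R -> R) := fine (moment P X (phi j) L) - mu j.

Variable LL : set (d.-tuple R -> R^o).
Hypothesis LL_int : forall L, LL L -> moment_integrable P X phi0 L /\
  forall j, moment_integrable P X (phi j) L.

Let momentaE L : LL L -> moment P X phi0 L = (a L)%:E.
Proof. by move=> /LL_int[+ _]; exact: momentE. Qed.

Let momenthE L j : LL L -> moment P X (phi j) L = (h j L + mu j)%:E.
Proof. by move=> /LL_int[_ /(_ j)/momentE->]; rewrite /h subrK. Qed.

Let lagrangianE lambda L : LL L -> lagrangian P X phi0 phi mu lambda L =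
  (a L - \sum_(j < m + k) lambda j * h j L)%:E.
Proof.
move=> LLL; rewrite /lagrangian momentaE// EFinB -sumEFin; congr (_ - _)%E.
by apply: eq_bigr => j _; rewrite momenthE// -EFinB addrK -EFinM.
Qed.

Let primal_feasibleE L : primal_feasible P X phi mu LL L <->
  [/\ LL L, forall i, h (lshift k i) L <= 0 & forall i, h (rshift m i) L = 0].
Proof.
split=> -[LLL le eq]; split=> // i.
- by have := le i; rewrite momenthE// lee_fin; lra.
- by have := eq i; rewrite momenthE// => -[]; lra.
- by rewrite momenthE// lee_fin; have := le i; lra.
- by rewrite momenthE// eq add0r.
Qed.

Lemma weak_duality :
  (val_primal P X phi0 phi mu LL <= val_dual P X phi0 phi mu LL)%E.
Proof.
apply: ge_ereal_sup => _ [L /primal_feasibleE[LLL le eq] <-].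
apply: le_ereal_inf_tmp => _ [lambda lambda_ge0 <-].
apply: le_trans (ereal_sup_ubound _); last by exists L.
(* At a feasible [L] the penalty sum is nonpositive: equality terms vanish, and inequality terms
   pair a nonnegative multiplier with a nonpositive value. *)
rewrite lagrangianE// momentaE// lee_fin lerDl oppr_ge0 big_split_ord/=.
rewrite [X in _ + X]big1 ?addr0; last by move=> i _; rewrite eq mulr0.
by apply: sumr_le0 => i _; rewrite mulr_ge0_le0.
Qed.

Lemma strong_duality : convex_set LL -> interior_point_condition P X phi mu LL ->
  val_primal P X phi0 phi mu LL = val_dual P X phi0 phi mu LL.
Proof.
move=> cLL [[L0 [LL0 lt0 eq0]] /equality_moments_ball[e e0 hint]].
apply/eqP; rewrite eq_le weak_duality/=.
have L0_slater : [/\ LL L0, forall i, h (lshift k i) L0 < 0 &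
    forall i, h (rshift m i) L0 = 0].
  split=> // i.
    by have := lt0 i; rewrite momenthE// lte_fin; lra.
  by have := eq0 i; rewrite momenthE// => -[]; lra.
have L0_feasible : primal_feasible P X phi mu LL L0.
  by apply/primal_feasibleE; case: L0_slater => ? le ?; split=> // i; exact/ltW.
have le_val L : primal_feasible P X phi mu LL L ->
    ((a L)%:E <= val_primal P X phi0 phi mu LL)%E.
  move=> FL; have [LLL _ _] := FL; rewrite -momentaE//.
  by apply: ereal_sup_ubound; exists L.
(* A real bound [p] is needed: the value [+oo] makes the claim trivial, and [-oo] is excluded by the
   feasible [L0]. *)
case: (val_primal _ _ _ _ _ _) le_val => [p| |] le_val; last 2 first.
- by rewrite leey.
- by have := le_val _ L0_feasible.
have [||||||l l_ge0 al] :=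
  @lagrange_multipliers R (convex_lmodType (d.-tuple R -> R^o))
    m k LL a h p e _ _ _ _ e0.
- by move=> L M t /mem_set LLL /mem_set LLM; exact/set_mem/cLL.
- have -> : a = fun L => fine (moment P X phi0 L) - 0.
    by apply/funext => L; rewrite subr0.
  by apply: moment_affine => L /LL_int[].
- by move=> j; apply: moment_affine => L /LL_int[].
- by exists L0.
- move=> v /hint[L LLL hL]; exists L => // i.
  by rewrite /h hL mxE/=; ring.
- move=> L LLL le eq; rewrite -lee_fin; apply: le_val.
  exact/primal_feasibleE.
(* The multiplier [l] is dual feasible, and its Lagrangian never exceeds [p] on [LL]. *)
apply: ge_ereal_inf; exists (ereal_sup
  [set lagrangian P X phi0 phi mu l L | L in LL]); first by exists l.
by apply: ge_ereal_sup => _ [L LLL <-]; rewrite lagrangianE// lee_fin; exact: al.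
Qed.

End duality.

Theorem theorem1 (R : realType) (d : nat)
  (S : set (d.-tuple R)) (mS : measurable S)
  (m k : nat) (phi0 : d.-tuple R -> R) (phi : 'I_(m + k) -> d.-tuple R -> R)
  (mu : 'I_(m + k) -> R)
  (total_mass : exists j : 'I_(m + k), forall x, S x -> phi j x = \1_S x)
  (F : set (d.-tuple R -> R))
  (F_ge0 : forall f, F f -> forall x, S x -> 0 <= f x)
  (g : d.-tuple R -> R) (g_density : is_positive_density S g)
  (dO : measure_display) (Omega : measurableType dO)
  (P : probability Omega R) (X : {RV P >-> d.-tuple R})
  (X_density : has_density S X g) :
  let LL := likelihood_ratios S g F in
  (forall L, LL L -> moment_integrable P X phi0 L /\
     forall j : 'I_(m + k), moment_integrable P X (phi j) L) ->
  (val_primal P X phi0 phi mu LL <= val_dual P X phi0 phi mu LL)%E /\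
  (convex_set LL -> interior_point_condition P X phi mu LL ->
   val_primal P X phi0 phi mu LL = val_dual P X phi0 phi mu LL).
Proof.
by move=> LL LL_int; split; [exact: weak_duality|exact: strong_duality].
Qed.
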